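(* If $m,n \geq 1$ are integers, then \[ \gamma(H_{m,n})\geq \left\lceil \frac{2m+n(4m+2)}{4} \right\rceil.\]
   Context: The infinite truncated square tiling graph $H_{\infty,\infty}$ has vertex set $\{(a,(x,y)) : a\in\mathbb{Z}_4,\ (x,y)\in\mathbb{Z}^2\}$. Its edges are: $(a,(x,y))\sim(a+1,(x,y))$ with $a+1$ taken modulo 4 (so each $(x,y)$ carries a 4-cycle whose vertices $0,1,2,3$ are its top, right, bottom, left vertices); $(1,(x,y))\sim(3,(x+1,y))$; and $(0,(x,y))\sim(2,(x,y+1))$. For $(x,y)\in\mathbb{Z}^2$ the octagon $O_{x,y}$ is the 8-cycle through $(0,(x,y)),(1,(x,y)),(3,(x+1,y)),(0,(x+1,y)),(2,(x+1,y+1)),(3,(x+1,y+1)),(1,(x,y+1)),(2,(x,y+1))$, in this cyclic order. For positive integers $m,n$, $H_{m,n}$ is the finite subgraph consisting of $m$ rows of $n$ octagons each: the union of the octagons $O_{x,y}$ with $0\le x\le n-1$, $0\le y\le m-1$. $\gamma(G)$ denotes the domination number of a finite graph $G$: the smallest cardinality of a set $T$ of vertices such that every vertex of $G$ is in $T$ or adjacent to a vertex of $T$. *)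

(* Defs.v *)
From HB Require Import structures.
From mathcomp Require Import all_boot all_order all_algebra.
From mathcomp Require Import zify.

Set Implicit Arguments.
Unset Strict Implicit.
Unset Printing Implicit Defensive.

Import Order.TTheory GRing.Theory Num.Theory.

Section Domination.
Variables (T : finType) (e : rel T).

Definition dominating (D : {set T}) : bool :=
  [forall v, (v \in D) || [exists u in D, e v u]].

Definition domination_number : nat :=
  #|[arg min_(D < [set: T] | dominating D) #|D|]|.

Lemma dominatingT : dominating [set: T].
Proof. by apply/forallP => v; rewrite inE. Qed.

Lemma domination_number_witness :
  exists2 D : {set T}, dominating D & #|D| = domination_number.
Proof.
by rewrite /domination_number; case: arg_minnP => [|D]; [exact: dominatingT | exists D].
Qed.

Lemma domination_number_min (D : {set T}) :
  dominating D -> domination_number <= #|D|.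
Proof.
by rewrite /domination_number; case: arg_minnP => [|E _ Emin]; [exact: dominatingT | exact: Emin].
Qed.

End Domination.

Local Open Scope ring_scope.

Definition tvertex : Type := ('Z_4 * (int * int))%type.

(* One orientation of each edge of the infinite tiling graph; tiling_adj is its
   symmetric closure. *)
Definition tiling_arc (u v : tvertex) : bool :=
  let: (a, (x, y)) := u in
  [|| v == (a + 1, (x, y)),
      (a == 1) && (v == (3, (x + 1, y)))
    | (a == 0) && (v == (2, (x, y + 1)))].

Definition tiling_adj (u v : tvertex) : bool := tiling_arc u v || tiling_arc v u.

Definition octagon (x y : int) : seq tvertex :=
  [:: (0, (x, y)); (1, (x, y)); (3, (x + 1, y)); (0, (x + 1, y));
      (2, (x + 1, y + 1)); (3, (x + 1, y + 1)); (1, (x, y + 1)); (2, (x, y + 1))].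

Definition octagon_adj (x y : int) (u v : tvertex) : bool :=
  [&& u \in octagon x y, v \in octagon x y
    & (v == next (octagon x y) u) || (u == next (octagon x y) v)].

Definition H_vertices (m n : nat) : seq tvertex :=
  [seq u | x <- iota 0 n, u <- flatten [seq octagon x%:Z y%:Z | y <- iota 0 m]].

(* The finite type of the vertices of H_{m,n}; seq_sub ignores repetitions in
   the list. *)
Definition H_vertex (m n : nat) : finType := seq_sub (H_vertices m n).

Definition H_adj (m n : nat) : rel (H_vertex m n) :=
  fun u v => [exists x : 'I_n, exists y : 'I_m,
                octagon_adj x%:Z y%:Z (val u) (val v)].

Lemma mem_H_vertices (m n : nat) (u : tvertex) :
  (u \in H_vertices m n) =
  [exists x : 'I_n, exists y : 'I_m, u \in octagon x%:Z y%:Z].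
Proof.
apply/idP/existsP => [|[x /existsP[y uO]]].
- case/allpairsPdep => x [v] [xn /flatten_mapP[y ym vO] ->].
  move: xn ym; rewrite !mem_iota !add0n !leq0n /= => xn ym.
  by exists (Ordinal xn); apply/existsP; exists (Ordinal ym).
- apply/allpairsPdep; exists (nat_of_ord x), u; split => //.
    by rewrite mem_iota add0n leq0n /=.
  apply/flatten_mapP; exists (nat_of_ord y) => //.
  by rewrite mem_iota add0n leq0n /=.
Qed.

Lemma octagon_uniq (x y : int) : uniq (octagon x y).
Proof.
have neS (z : int) : (z == z + 1) = false by lia.
have neS' (z : int) : (z + 1 == z) = false by lia.
by rewrite /octagon /= !inE !xpair_eqE !eqxx ?neS ?neS'.
Qed.

Lemma octagon_cycle (x y : int) : cycle tiling_adj (octagon x y).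
Proof. by rewrite /octagon /= /tiling_adj /tiling_arc /= !xpair_eqE !eqxx. Qed.

Lemma octagon_adj_tiling (x y : int) (u v : tvertex) :
  octagon_adj x y u v -> tiling_adj u v.
Proof.
case/and3P => uO vO /orP[] /eqP ->; last rewrite /tiling_adj orbC.
- exact: next_cycle (octagon_cycle x y) uO.
- exact: next_cycle (octagon_cycle x y) vO.
Qed.

Lemma tiling_adj_irrefl : irreflexive tiling_adj.
Proof.
move=> [a [x y]]; rewrite /tiling_adj orbb /tiling_arc !xpair_eqE.
have neS (z : int) : (z == z + 1) = false by lia.
rewrite !neS !andbF !orbF !eqxx !andbT.
by case: a; do 4?case=> //.
Qed.

Lemma H_adj_sym (m n : nat) : symmetric (@H_adj m n).
Proof.
move=> u v; apply: eq_existsb => x; apply: eq_existsb => y.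
by rewrite /octagon_adj andbCA orbC.
Qed.

Lemma H_adj_irrefl (m n : nat) : irreflexive (@H_adj m n).
Proof.
move=> u; apply/existsP => -[x] /existsP[y] /octagon_adj_tiling.
by rewrite tiling_adj_irrefl.
Qed.

(* Main.v *)
Require Import Defs.
From mathcomp Require Import all_boot all_order all_algebra.
From mathcomp Require Import zify.
Import Order.TTheory GRing.Theory Num.Theory.
Local Open Scope ring_scope.

(** The bound is the volume bound for domination. In a graph of maximum degree
    at most 3, a vertex dominates at most 4 vertices, itself included, so every
    dominating set contains at least a quarter of the vertices
    ([leq_card_domination_number]). A vertex of the tiling
    graph has its neighbours among three vertices, two in its 4-cycle and one
    outside ([tiling_adj_nbrs]), and H_{m,n} is a subgraph of that graph
    ([H_degree_le3]).

    To count the vertices of H_{m,n}, sort them by their position in their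
    4-cycle. The top vertices are the (0, (x, y)) with 0 <= x <= n and
    0 <= y < m, because the octagons O_{x,y} and O_{x-1,y} both contain
    (0, (x, y)); the bottom vertices are the same grid shifted up by one. The
    right and left vertices likewise form two grids of size n * (m + 1). This
    gives 2 (n + 1) m + 2 n (m + 1) = 4 m n + 2 m + 2 n vertices
    ([leq_card_H_vertex]), a quarter of which is the quantity under the
    ceiling. *)

(** The closed neighbourhoods of the members of a dominating set cover the
    graph, and each has at most d + 1 elements. *)
Lemma leq_card_domination_number {T : finType} {e : rel T} {d : nat} :
  (forall u, #|[set v | e v u]| <= d)%N ->
  (#|T| <= d.+1 * domination_number e)%N.
Proof.
move=> deg_le; have [D /forallP domD <-] := domination_number_witness e.
have cover : [set: T] \subset \bigcup_(u in D) (u |: [set v | e v u]).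
  apply/subsetP => v _; apply/bigcupP.
  have /orP[vD|/existsP[u /andP[uD evu]]] := domD v.
    by exists v; rewrite // setU11.
  by exists u; rewrite // !inE evu orbT.
rewrite -cardsT mulnC -sum_nat_const.
apply: leq_trans (subset_leq_card cover) _.
apply: (big_ind2 (fun (A : {set T}) k => #|A| <= k)%N); first by rewrite cards0.
- by move=> A k B l Ak Bl; apply: leq_trans (leq_card_setU A B) (leq_add Ak Bl).
- by move=> u _; rewrite cardsU1 -add1n leq_add ?leq_b1.
Qed.

Definition tiling_nbrs (u : tvertex) : seq tvertex :=
  let: (a, (x, y)) := u in
  [:: (a + 1, (x, y)); (a - 1, (x, y));
      if a == 0 then (2, (x, y + 1)) else
      if a == 1 then (3, (x + 1, y)) else
      if a == 2 then (0, (x, y - 1)) else (1, (x - 1, y))].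

Lemma tiling_adj_nbrs {u v : tvertex} : tiling_adj v u -> v \in tiling_nbrs u.
Proof.
case: u v => a [x y] [b [z t]].
rewrite /tiling_adj /tiling_arc /tiling_nbrs !inE !xpair_eqE.
case: a => [[|[|[|[|//]]]] ?]; case: b => [[|[|[|[|//]]]] ?];
  rewrite -!val_eqE /= ?xpair_eqE -?val_eqE /=; lia.
Qed.

Lemma H_degree_le3 {m n : nat} (u : H_vertex m n) :
  (#|[set v | H_adj v u]| <= 3)%N.
Proof.
have <- : size (tiling_nbrs (val u)) = 3%N by case: (val u) => a [].
rewrite cardE -(size_map val); apply: uniq_leq_size.
  by rewrite (map_inj_uniq val_inj) enum_uniq.
move=> _ /mapP[v + ->]; rewrite mem_enum inE.
by case/existsP => x /existsP[y /octagon_adj_tiling /tiling_adj_nbrs].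
Qed.

Lemma octagon_sub_H {m n} (x y : nat) {u : tvertex} :
  (x < n)%N -> (y < m)%N -> u \in octagon x%:Z y%:Z -> u \in H_vertices m n.
Proof.
move=> xn ym uO; rewrite mem_H_vertices.
by apply/existsP; exists (Ordinal xn); apply/existsP; exists (Ordinal ym).
Qed.

(** A parametrization of the vertices of H_{m,n} by four full rectangles: tops
    and bottoms in the left summand, rights and lefts in the right one. Bottoms
    are shifted up and lefts to the right because the outermost 4-cycles lack
    the vertices that would stick out of the octagons. *)
Definition H_grid {m n : nat}
    (t : bool * ('I_n.+1 * 'I_m) + bool * ('I_n * 'I_m.+1)) : tvertex :=
  match t with
  | inl (b, (x, y)) => if b then (0, (x%:Z, y%:Z)) else (2, (x%:Z, y%:Z + 1))
  | inr (b, (x, y)) => if b then (1, (x%:Z, y%:Z)) else (3, (x%:Z + 1, y%:Z))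
  end.

Lemma H_grid_inj {m n : nat} : injective (@H_grid m n).
Proof.
move=> [[[] [x y]]|[[] [x y]]] [[[] [z t]]|[[] [z t]]] //= [exz eyt];
  (have -> : x = z by apply: val_inj => /=; lia);
  by have -> : y = t by apply: val_inj => /=; lia.
Qed.

Lemma H_grid_mem {m n : nat}
    (t : bool * ('I_n.+1 * 'I_m) + bool * ('I_n * 'I_m.+1)) :
  (1 <= m)%N -> (1 <= n)%N -> H_grid t \in H_vertices m n.
Proof.
move=> hm hn; case: t => [[b [x y]]|[b [x y]]].
- have [xn|nx] := ltnP x n.
    apply: (octagon_sub_H x y) => //.
    by case: b; rewrite /= !inE eqxx ?orbT.
  (* There is one more column of 4-cycles than of octagons: the tops and
     bottoms with x = n lie on the right side of the octagons O_{n-1,y}.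
     Likewise below, the rights and lefts with y = m lie on the upper side of
     the octagons O_{x,m-1}. *)
  have ex : x%:Z = n.-1%:Z + 1 by have := ltn_ord x; lia.
  apply: (octagon_sub_H n.-1 y) => //; first by rewrite prednK.
  by case: b; rewrite /= ex !inE eqxx ?orbT.
- have [ym|my] := ltnP y m.
    apply: (octagon_sub_H x y) => //.
    by case: b; rewrite /= !inE eqxx ?orbT.
  have ey : y%:Z = m.-1%:Z + 1 by have := ltn_ord y; lia.
  apply: (octagon_sub_H x m.-1) => //; first by rewrite prednK.
  by case: b; rewrite /= ey !inE eqxx ?orbT.
Qed.

Lemma leq_card_H_vertex {m n : nat} : (1 <= m)%N -> (1 <= n)%N ->
  (2 * m + n * (4 * m + 2) <= #|H_vertex m n|)%N.
Proof.
move=> hm hn.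
pose f t : H_vertex m n := SeqSub (H_grid_mem t hm hn).
have f_inj : injective f by move=> s t /(congr1 val) /H_grid_inj.
have := leq_card f f_inj.
rewrite card_sum !card_prod card_bool !card_ord; lia.
Qed.

Theorem theorem2p9 (m n : nat) (hm : (1 <= m)%N) (hn : (1 <= n)%N) :
  Num.ceil ((2 * m%:R + n%:R * (4 * m%:R + 2)) / 4 : rat)
    <= (domination_number (@H_adj m n))%:Z.
Proof.
have := leq_card_domination_number (@H_degree_le3 m n).
move=> /(leq_trans (leq_card_H_vertex hm hn)).
rewrite -(ler_nat rat) !(natrD, natrM) => le4.
rewrite ceil_le_int ler_pdivrMr // [leRHS]mulrC.
exact: le4.
Qed.
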